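(* In the setting described in the context, the limit $C_{N_t,N_r}(\infty)=\lim_{\mathsf{SNR}\to\infty}C_{N_t,N_r}(\mathsf{SNR})$ is finite and satisfies $$M\log_2\!\Big(1+\frac{1}{\kappa^2}\Big)\le C_{N_t,N_r}(\infty)\le M\log_2\!\Big(1+\frac{N_t}{M\kappa^2}\Big),$$ where $M=\min(N_t,N_r)$. The lower bound is asymptotically (as $\mathsf{SNR}\to\infty$) achieved by the choice $\mathbf{Q}=\frac{1}{N_t}\mathbf{I}$, i.e., with Gaussian input $\mathbf{x}\sim\mathcal{CN}(\mathbf{0},\frac1{N_t}\mathbf{I})$. The two bounds coincide if $N_t\le N_r$.
   Context: Setting (MIMO channel with transmitter impairments). Let $N_t,N_r\ge1$ be the numbers of transmit and receive antennas, $\mathsf{SNR}>0$. The received signal is $\mathbf{y}=\sqrt{\mathsf{SNR}}\,\mathbf{H}(\mathbf{x}+\boldsymbol{\eta}_t)+\mathbf{n}\in\mathbb{C}^{N_r}$, where $\mathbf{x}\in\mathbb{C}^{N_t}$ is the intended signal with covariance $\mathbf{Q}=\mathbb{E}\{\mathbf{x}\mathbf{x}^H\}$ subject to $\mathrm{tr}(\mathbf{Q})=1$; $\mathbf{n}\sim\mathcal{CN}(\mathbf{0},\mathbf{I})$; the channel $\mathbf{H}\in\mathbb{C}^{N_r\times N_t}$ is a random matrix $\mathbb{H}$ with some distribution $f_{\mathbb{H}}$ satisfying $\mathbb{E}\{\mathrm{tr}(\mathbf{H}^H\mathbf{H})\}=N_tN_r$ and $\mathrm{rank}(\mathbf{H})=\min(N_t,N_r)$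 almost surely. The transmitter distortion is $\boldsymbol{\eta}_t\sim\mathcal{CN}(\mathbf{0},\boldsymbol{\Upsilon}_t(\mathbf{Q}))$, independent of $\mathbf{x}$, $\mathbf{n}$, $\mathbf{H}$, with $\boldsymbol{\Upsilon}_t(\mathbf{Q})=\mathrm{diag}(\upsilon_1(q_1),\dots,\upsilon_{N_t}(q_{N_t}))$, $q_n$ the $n$th diagonal element of $\mathbf{Q}$, and $\upsilon_n(q_n)=\kappa^2\big((1-\alpha)q_n+\alpha\frac{1}{N_t}\sum_{i=1}^{N_t}q_i\big)$ for fixed $\alpha\in[0,1]$, $\kappa>0$. The receiver knows $\mathbf{H}$, the transmitter only $f_{\mathbb{H}}$. The capacity is $C_{N_t,N_r}(\mathsf{SNR})=\sup_{f_{\mathbb{X}}:\ \mathrm{tr}(\mathbb{E}\{\mathbf{x}\mathbf{x}^H\})=1}\mathcal{I}(\mathbf{x};\mathbf{y}\mid\mathbb{H})$, where $\mathcal{I}(\mathbf{x};\mathbf{y}\mid\mathbb{H})=\mathbb{E}_{\mathbf{H}}\{\mathcal{I}(\mathbf{x};\mathbf{y}\mid\mathbb{H}=\mathbf{H})\}$; equivalently it equals $\sup_{\mathbf{Q}\succeq\mathbf{0},\,\mathrm{tr}(\mathbf{Q})=1}\mathbb{E}_{\mathbf{H}}\{\log_2\det(\mathbf{I}+\mathsf{SNR}\,\mathbf{H}\mathbf{Q}\mathbf{H}^H(\mathsf{SNR}\,\mathbf{H}\boldsymbol{\Upsilon}_t(\mathbf{Q})\mathbf{H}^H+\mathbf{I})^{-1})\}$,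 achieved by Gaussian inputs. *)

(* Defs.v *)
From HB Require Import structures.
From mathcomp Require Import all_boot all_order all_algebra.
From mathcomp Require Import all_classical all_reals all_analysis.
From mathcomp Require Import complex.
Set Implicit Arguments. Unset Strict Implicit. Unset Printing Implicit Defensive.
Import Order.TTheory GRing.Theory Num.Theory.
Local Open Scope ring_scope.
Local Open Scope complex_scope.

Section Channel.
Variable R : realType.

Definition herm (m n : nat) (A : 'M[R[i]]_(m, n)) : 'M[R[i]]_(n, m) :=
  (map_mx (@conjc R) A)^T.

Definition log2 (x : R) : R := ln x / ln 2.

Definition psd (n : nat) (Q : 'M[R[i]]_n) : Prop :=
  herm Q = Q /\ forall v : 'cV[R[i]]_n, 0 <= (herm v *m Q *m v) 0 0.

Definition admissible (n : nat) (Q : 'M[R[i]]_n) : Prop := psd Q /\ \tr Q = 1.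

Definition Upsilon (Nt : nat) (kappa alpha : R) (Q : 'M[R[i]]_Nt) : 'M[R[i]]_Nt :=
  diag_mx (\row_(n < Nt) ((kappa ^+ 2)%:C *
     ((1 - alpha)%:C * Q n n + alpha%:C * (Nt%:R)^-1 * \sum_(k < Nt) Q k k))).

Definition rate_H (Nt Nr : nat) (kappa alpha snr : R)
  (H : 'M[R[i]]_(Nr, Nt)) (Q : 'M[R[i]]_Nt) : R :=
  log2 (@complex.Re R (\det (1%:M + snr%:C *: (H *m Q *m herm H)
        *m invmx (snr%:C *: (H *m Upsilon kappa alpha Q *m herm H) + 1%:M)))).

Definition rate (d : measure_display) (T : measurableType d) (P : probability T R)
  (Nt Nr : nat) (H : T -> 'M[R[i]]_(Nr, Nt)) (kappa alpha snr : R)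
  (Q : 'M[R[i]]_Nt) : \bar R :=
  (\int[P]_w (rate_H kappa alpha snr (H w) Q)%:E)%E.

Definition capacity (d : measure_display) (T : measurableType d) (P : probability T R)
  (Nt Nr : nat) (H : T -> 'M[R[i]]_(Nr, Nt)) (kappa alpha snr : R) : \bar R :=
  ereal_sup [set rate P H kappa alpha snr Q | Q in [set Q | admissible Q]].

End Channel.

(* Main.v *)
(* Writing Q = V V^H and using det (1 + A B) = det (1 + B A), the rate becomes
   log2 det (1 + X) with X = (H V)^H (H U H^H + s^-1)^-1 (H V), where U is the
   distortion covariance and s the SNR. Inversion being antitone for the Loewner
   order, X increases with s, so every rate and hence the capacity is monotone
   in s. Since H^H (H U H^H + s^-1)^-1 H is dominated by U^-1 on the range of
   U, the trace of X is at most the sum of the ratios q_n / u_n, which is at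
   most Nt / kappa^2 by concavity; AM-GM over min(Nt, Nr) eigenvalues then
   bounds the rate uniformly in Q and s. For Q = I / Nt the rate is explicit
   in the eigenvalues of H H^H, exactly rank H of which are nonzero, and
   dominated convergence yields the limit. *)

Require Import Defs.
From HB Require Import structures.
From mathcomp Require Import all_boot all_order all_algebra.
From mathcomp Require Import all_classical all_reals all_analysis.
From mathcomp Require Import complex.
From mathcomp Require Import ring lra measurable_realfun.
Import Order.TTheory GRing.Theory Num.Theory numFieldNormedType.Exports.
Local Open Scope classical_set_scope.
Local Open Scope ring_scope.
Local Open Scope complex_scope.

Set Implicit Arguments.
Unset Strict Implicit.
Unset Printing Implicit Defensive.

(** The block matrix with rows [(1, -A)] and [(B, 1)] factors into block triangular matrices in two
    ways; the determinants of the two factorizations give the two sides. *)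
Lemma det1D_mulmxC (F : comNzRingType) (m n : nat) (A : 'M[F]_(m, n)) (B : 'M[F]_(n, m)) :
  \det (1%:M + A *m B) = \det (1%:M + B *m A).
Proof.
have E : block_mx 1%:M 0 B 1%:M *m block_mx 1%:M (- A) 0 (1%:M + B *m A)
       = block_mx (1%:M + A *m B) (- A) 0 1%:M *m block_mx 1%:M 0 B 1%:M.
  rewrite !mulmx_block !mul1mx !mul0mx !mulmx1 !mulmx0 !addr0 !add0r mulmxN mulNmx.
  by rewrite addrK addrCA addNr addr0.
have := congr1 determinant E.
by rewrite !det_mulmx !det_lblock !det_ublock !det1 !mul1r !mulr1.
Qed.

(** * Conjugate transposes and positive semidefinite matrices *)

Section Hermitian.
Variable R : realType.
Local Notation C := R[i].

Lemma hermE m n (A : 'M[C]_(m, n)) i j : herm A i j = conjc (A j i).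
Proof. by rewrite !mxE. Qed.

Lemma herm_mul m n p (A : 'M[C]_(m, n)) (B : 'M[C]_(n, p)) :
  herm (A *m B) = herm B *m herm A.
Proof. by rewrite /herm map_mxM trmx_mul. Qed.

Lemma hermD m n (A B : 'M[C]_(m, n)) : herm (A + B) = herm A + herm B.
Proof. by rewrite /herm map_mxD linearD. Qed.

Lemma hermB m n (A B : 'M[C]_(m, n)) : herm (A - B) = herm A - herm B.
Proof. by rewrite /herm map_mxB linearB. Qed.

Lemma hermK m n (A : 'M[C]_(m, n)) : herm (herm A) = A.
Proof. by apply/matrixP => i j; rewrite !hermE conjcK. Qed.

Lemma hermZ m n (a : R) (A : 'M[C]_(m, n)) : herm (a%:C *: A) = a%:C *: herm A.
Proof. by apply/matrixP => i j; rewrite !mxE rmorphM /= oppr0. Qed.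

Lemma herm_diag n (d : 'I_n -> R) :
  herm (diag_mx (\row_j (d j)%:C)) = diag_mx (\row_j (d j)%:C).
Proof.
rewrite /herm map_diag_mx tr_diag_mx; congr diag_mx.
by apply/rowP => j; rewrite !mxE /= oppr0.
Qed.

Lemma herm_inv n (A : 'M[C]_n) : herm (invmx A) = invmx (herm A).
Proof. by rewrite /herm map_invmx trmx_inv. Qed.

Lemma psd_herm n (A : 'M[C]_n) : psd A -> herm A = A. Proof. by case. Qed.

Lemma psd_congr m n (A : 'M[C]_n) (B : 'M[C]_(n, m)) :
  psd A -> psd (herm B *m A *m B).
Proof.
move=> [hA pA]; split; first by rewrite !herm_mul hermK hA mulmxA.
by move=> v; have := pA (B *m v); rewrite herm_mul !mulmxA.
Qed.

Lemma psd_congr_herm m n (A : 'M[C]_n) (B : 'M[C]_(m, n)) :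
  psd A -> psd (B *m A *m herm B).
Proof. by move=> pA; rewrite -{1}[B]hermK; exact: psd_congr. Qed.

Lemma psdD n (A B : 'M[C]_n) : psd A -> psd B -> psd (A + B).
Proof.
move=> [hA pA] [hB pB]; split; first by rewrite hermD hA hB.
by move=> v; rewrite mulmxDr mulmxDl mxE addr_ge0.
Qed.

Lemma psdZ n (a : R) (A : 'M[C]_n) : 0 <= a -> psd A -> psd (a%:C *: A).
Proof.
move=> a0 [hA pA]; split; first by rewrite hermZ hA.
by move=> v; rewrite -scalemxAr -scalemxAl mxE mulr_ge0 ?ler0c.
Qed.

Lemma psd_diag n (d : 'I_n -> R) :
  (forall i, 0 <= d i) -> psd (diag_mx (\row_j (d j)%:C) : 'M[C]_n).
Proof.
move=> d0; split; first exact: herm_diag.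
move=> v; rewrite mxE sumr_ge0// => j _.
rewrite mul_mx_diag !mxE mulrAC mulr_ge0 ?ler0c//.
by rewrite mulrC mulcJ_ge0.
Qed.

Lemma psd1 n : psd (1%:M : 'M[C]_n).
Proof.
have -> : 1%:M = diag_mx (\row_j ((fun=> 1) j)%:C) :> 'M[C]_n; last first.
  by apply: psd_diag => _; exact: ler01.
by rewrite -diag_const_mx; congr diag_mx; apply/rowP => j; rewrite !mxE.
Qed.

Lemma psd_scalar n (a : R) : 0 <= a -> psd (a%:C%:M : 'M[C]_n).
Proof. by move=> a0; rewrite -scalemx1; apply: psdZ => //; exact: psd1. Qed.

Lemma psd_gram m n (A : 'M[C]_(m, n)) : psd (herm A *m A).
Proof. by have := psd_congr A (psd1 m); rewrite mulmx1. Qed.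

Lemma psd_diag_ge0 n (A : 'M[C]_n) i : psd A -> 0 <= A i i.
Proof.
move=> [_ /(_ (delta_mx i 0))]; rewrite -mulmxA -colE mxE (bigD1 i)//=.
rewrite hermE !mxE !eqxx conjc1 mul1r big1 ?addr0// => j ji.
by rewrite hermE !mxE (negbTE ji) conjc0 mul0r.
Qed.

Lemma psd_trace_ge0 n (A : 'M[C]_n) : psd A -> 0 <= \tr A.
Proof. by move=> pA; apply: sumr_ge0 => i _; apply: psd_diag_ge0. Qed.

(** The spectral theorem for normal matrices yields complex eigenvalues. They are the diagonal
    entries of [P *m A *m herm P], hence nonnegative and in particular real, so taking real parts
    loses nothing. *)
Lemma psd_spectral n (A : 'M[C]_n) : psd A ->
  exists (P : 'M[C]_n) (d : 'I_n -> R),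
    [/\ herm P *m P = 1%:M, (forall i, 0 <= d i) &
        A = herm P *m diag_mx (\row_j (d j)%:C) *m P].
Proof.
move=> pA.
have [P [D [PP AE]]] : exists (P : 'M[C]_n) (D : 'rV[C]_n),
    P *m herm P = 1%:M /\ A = herm P *m diag_mx D *m P.
  have hE m p (B : 'M[C]_(m, p)) : herm B = map_mx Num.conj (B^T).
    by rewrite /herm map_trmx.
  have /orthomx_spectralP AE : A \is normalmx.
    by apply/normalmxP; rewrite -hE psd_herm.
  have uP := spectral_unitarymx A.
  exists (spectralmx A), (spectral_diag A).
  by rewrite hE -invmx_unitary//; split => //; exact/mulmxV/spectral_unit.
have D0 i : 0 <= D 0 i.
  have : psd (P *m A *m herm P).
    exact: psd_congr_herm.
  rewrite AE !mulmxA PP mul1mx -mulmxA PP mulmx1 => /(psd_diag_ge0 i).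
  by rewrite mxE eqxx mulr1n.
exists P, (fun j => complex.Re (D 0 j)); split.
- exact: mulmx1C.
- by move=> i; have := D0 i; rewrite lecE => /andP[].
- rewrite {1}AE; congr (_ *m diag_mx _ *m _); apply/rowP => j; rewrite mxE.
  by have := ger0_Im (D0 j); case: (D 0 j) => a b /= ->.
Qed.

Lemma psd_sqrt n (A : 'M[C]_n) : psd A -> exists V : 'M[C]_n, A = V *m herm V.
Proof.
move=> /psd_spectral[P [d [_ d0 ->]]].
exists (herm P *m diag_mx (\row_j (Num.sqrt (d j))%:C)).
rewrite herm_mul hermK herm_diag !mulmxA; congr (_ *m P).
rewrite -mulmxA; congr (_ *m _); rewrite mulmx_diag; congr diag_mx.
by apply/rowP => j; rewrite !mxE -rmorphM /= -expr2 sqr_sqrtr.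
Qed.

(** * Determinants of [1 + A] through eigenvalues *)

Lemma unitary_conj_det n (P A : 'M[C]_n) : herm P *m P = 1%:M ->
  \det (1%:M + herm P *m A *m P) = \det (1%:M + A).
Proof.
by move=> PP; rewrite det1D_mulmxC mulmxA (mulmx1C PP) mul1mx.
Qed.

Lemma det1D_diag n (d : 'I_n -> R) :
  \det (1%:M + diag_mx (\row_j (d j)%:C)) = \prod_j (1 + (d j)%:C) :> C.
Proof.
have -> : 1%:M = diag_mx (\row__ 1) :> 'M[C]_n.
  by rewrite -diag_const_mx; congr diag_mx; apply/rowP => j; rewrite !mxE.
by rewrite -linearD /= det_diag; apply: eq_bigr => j _; rewrite !mxE.
Qed.

Lemma psd_det1D_ge1 n (A : 'M[C]_n) : psd A -> 1 <= \det (1%:M + A).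
Proof.
move=> /psd_spectral[P [d [PP d0 ->]]]; rewrite unitary_conj_det// det1D_diag.
elim/big_ind: _ => [//|x y x1 y1|i _]; first exact: mulr_ege1.
by rewrite lerDl ler0c.
Qed.

(** AM-GM applied to the eigenvalues [1 + d j], whose mean is [1 + \tr A / n]. *)
Lemma psd_det1D_le n (A : 'M[C]_n) : (0 < n)%N -> psd A ->
  \det (1%:M + A) <= (1 + \tr A / n%:R) ^+ n.
Proof.
move=> n0 /psd_spectral[P [d [PP d0 ->]]]; rewrite unitary_conj_det// det1D_diag.
rewrite mxtrace_mulC mulmxA (mulmx1C PP) mul1mx mxtrace_diag.
under [in leRHS]eq_bigr do rewrite mxE.
have [+ _] := @leif_AGM C 'I_n predT (fun j => 1 + (d j)%:C)
  (fun i _ => addr_ge0 ler01 (etrans (ler0c _) (d0 i))).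
rewrite cardT size_enum_ord big_split /= sumr_const cardT size_enum_ord mulrDl.
have nN0 : (n%:R : C) != 0 by rewrite pnatr_eq0 -lt0n.
rewrite (mulfV nN0).
by [].
Qed.

(** * Inverses and the Loewner order *)

Lemma psd_invmx n (A : 'M[C]_n) : A \in unitmx -> psd A -> psd (invmx A).
Proof.
move=> uA pA; have := psd_congr (invmx A) pA.
by rewrite herm_inv (psd_herm pA) (mulVmx uA) mul1mx.
Qed.

(** [A + t] equals [t (1 + A / t)], and the second factor has determinant at least 1. *)
Lemma unitmx_psdD n (A : 'M[C]_n) (t : R) : 0 < t -> psd A ->
  A + t%:C%:M \in unitmx.
Proof.
move=> t0 pA; have tN0 : t%:C != 0 by rewrite eq_complex/= gt_eqF.
have -> : A + t%:C%:M = t%:C *: (1%:M + t^-1%:C *: A).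
  rewrite scalerDr scalemx1 scalerA -rmorphM /= mulfV ?gt_eqF//.
  by rewrite scale1r addrC.
rewrite unitmxZ ?unitfE// unitmxE unitfE gt_eqF// (lt_le_trans ltr01)//.
by apply: psd_det1D_ge1; apply: psdZ => //; rewrite invr_ge0 ltW.
Qed.

(** [1 + B] factors as [(1 + A)] times [1 + (1 + A)^-1 (B - A)]. With [(1 + A)^-1 = W herm W],
    cycling [W] to the right turns the second determinant into that of 1 plus a positive
    semidefinite matrix, which is at least 1. *)
Lemma psd_det1D_mono n (A B : 'M[C]_n) : psd A -> psd (B - A) ->
  \det (1%:M + A) <= \det (1%:M + B).
Proof.
move=> pA pBA.
have pZ : psd (1%:M + A) := psdD (psd1 n) pA.
have uZ : 1%:M + A \in unitmx by rewrite addrC; exact: (unitmx_psdD ltr01).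
have [W WE] := psd_sqrt (psd_invmx uZ pZ).
have -> : 1%:M + B = (1%:M + A) *m (1%:M + invmx (1%:M + A) *m (B - A)).
  by rewrite mulmxDr mulmx1 mulKVmx// addrACA subrr addr0.
rewrite det_mulmx WE -mulmxA det1D_mulmxC ler_peMr//.
  by rewrite (le_trans ler01)// psd_det1D_ge1.
by apply: psd_det1D_ge1; exact: psd_congr.
Qed.

(** With [D = A^-1 - B^-1], expanding shows [D = D A D + B^-1 (B - A) B^-1], a sum of two
    congruences of positive semidefinite matrices. *)
Lemma psd_invmxB n (A B : 'M[C]_n) : A \in unitmx -> B \in unitmx ->
  psd A -> psd B -> psd (B - A) -> psd (invmx A - invmx B).
Proof.
move=> uA uB pA pB pBA.
have hA := psd_herm (psd_invmx uA pA); have hB := psd_herm (psd_invmx uB pB).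
have -> : invmx A - invmx B = herm (invmx A - invmx B) *m A *m (invmx A - invmx B)
    + herm (invmx B) *m (B - A) *m invmx B; last first.
  exact: psdD (psd_congr _ pA) (psd_congr _ pBA).
rewrite hermB hA hB !(mulmxBl, mulmxBr) !(mulVmx uA, mulVmx uB) !mul1mx.
rewrite -!mulmxA (mulmxV uA) mulmx1.
by rewrite subrK.
Qed.

(* The difference is a sum of two positive semidefinite matrices: it equals
   [herm (W - p) U (W - p) + t herm y y] with
   [y = (K U herm K + t)^-1 K U W] and [p = herm K y]. *)
Lemma psd_resolvent_le m n p (t : R) (U : 'M[C]_n) (K : 'M[C]_(m, n))
    (W : 'M[C]_(n, p)) : 0 < t -> psd U ->
  psd (herm W *m U *m W - herm (K *m U *m W) *m
       invmx (K *m U *m herm K + t%:C%:M) *m (K *m U *m W)).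
Proof.
move=> t0 pU; set Z := K *m U *m herm K + _; set a := K *m U *m W.
have pB : psd (K *m U *m herm K) by rewrite -{1}[K]hermK; exact: psd_congr.
have uZ : Z \in unitmx := unitmx_psdD t0 pB.
have pZ : psd Z := psdD pB (psd_scalar _ (ltW t0)).
set y := invmx Z *m a; set q := herm K *m y.
have hU := psd_herm pU.
have <- : herm (W - q) *m U *m (W - q) + t%:C *: (herm y *m y) =
    herm W *m U *m W - herm a *m invmx Z *m a; last first.
  exact: psdD (psd_congr _ pU) (psdZ (ltW t0) (psd_gram y)).
have yE : herm y = herm a *m invmx Z.
  by rewrite herm_mul (psd_herm (psd_invmx uZ pZ)).
have aE : herm a = herm W *m U *m herm K by rewrite !herm_mul hU !mulmxA.
have qU : herm q *m U *m W = herm y *m a by rewrite herm_mul hermK !mulmxA.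
have Uq : herm W *m U *m q = herm y *m a.
  by rewrite yE -mulmxA -/y aE !mulmxA.
have qq : herm q *m U *m q + t%:C *: (herm y *m y) = herm y *m a.
  have <- : Z *m y = a by rewrite mulKVmx.
  by rewrite mulmxDl mulmxDr mul_scalar_mx -scalemxAr herm_mul hermK !mulmxA.
have cancel (V : zmodType) (w x b c : V) :
    b + c = x -> w - x - (x - b) + c = w - x.
  by move=> <-; rewrite [_ + c - b]addrAC subrr add0r subrK.
rewrite -yE hermB !mulmxBl !mulmxBr qU Uq.
exact: cancel qq.
Qed.

(** [herm Y *m Y] and [Y *m herm Y] give the same determinant and have the same trace, so AM-GM can
    be applied to the smaller of the two. This is where the factor [min(Nt, Nr)] of the upper bound
    originates. *)
Lemma gram_det_le m n (Y : 'M[C]_(m, n)) : (0 < m)%N -> (0 < n)%N ->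
  \det (1%:M + herm Y *m Y) <=
  (1 + \tr (herm Y *m Y) / (minn n m)%:R) ^+ minn n m.
Proof.
move=> m0 n0; have [nm|mn] := leqP n m.
  by apply: psd_det1D_le n0 _; exact: psd_gram.
rewrite det1D_mulmxC mxtrace_mulC; apply: psd_det1D_le m0 _.
by rewrite -{1}[Y]hermK; exact: psd_gram.
Qed.

(** * Ranks of Gram and diagonal matrices *)

Lemma mulmx_herm_eq0 m n (A : 'M[C]_(m, n)) : A *m herm A = 0 -> A = 0.
Proof.
move=> A0; apply/matrixP => i j; rewrite mxE.
have /eqP : (A *m herm A) i i = 0 by rewrite A0 mxE.
rewrite mxE psumr_eq0 => [|k _]; last by rewrite hermE mulcJ_ge0.
move=> /allP/(_ j (mem_index_enum _))/=; rewrite hermE mulf_eq0.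
by rewrite fmorph_eq0 orbb => /eqP.
Qed.

(** The rank lost is that of [N], the part of the row space of [A] killed by [herm A]. Writing
    [N = X *m A], one gets [N *m herm N = N *m herm A *m herm X = 0], so [N] vanishes. *)
Lemma mxrank_mul_herm m n (A : 'M[C]_(m, n)) : \rank (A *m herm A) = \rank A.
Proof.
rewrite -[RHS](mxrank_mul_ker A (herm A)).
set N := (A :&: kermx (herm A))%MS; suff -> : N = 0 by rewrite mxrank0 addn0.
have /submxP[X NE] : (N <= A)%MS by exact: capmxSl.
have /sub_kermxP NA : (N <= kermx (herm A))%MS by exact: capmxSr.
by apply: mulmx_herm_eq0; rewrite {2}NE herm_mul mulmxA NA mul0mx.
Qed.
End Hermitian.

Lemma mxrank_diag (F : fieldType) (n : nat) (d : 'rV[F]_n) :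
  \rank (diag_mx d) = #|[pred i | d 0 i != 0]|.
Proof.
elim: n d => [|n IHn] d.
  by rewrite flatmx0 mxrank0 eq_card0// => -[].
have dE : d = row_mx (lsubmx (d : 'rV_(1 + n))) (rsubmx (d : 'rV_(1 + n))).
  by rewrite hsubmxK.
rewrite {1}dE (@diag_mx_row _ n 1) (@rank_diag_block_mx F 1 1 n n) IHn.
rewrite -!sum1_card [RHS](@big_split_ord _ _ _ 1 n)/=; congr (_ + _)%N.
  rewrite rank_rV big_mkcond big_ord1 inE.
  suff -> : (diag_mx (lsubmx (d : 'rV_(1 + n))) == 0) = (d 0 (@lshift 1 n 0) == 0).
    by case: eqP.
  apply/eqP/eqP => [/matrixP/(_ 0 0)|d0]; first by rewrite !mxE eqxx mulr1n.
  by apply/matrixP => i j; rewrite !ord1 !mxE d0 mul0rn.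
apply: eq_bigl => i; rewrite !inE mxE.
by [].
Qed.

(** * Antenna powers and distortion variances *)

Section Channel.
Variables (R : realType) (Nt Nr : nat) (kappa alpha : R).
Hypotheses (Nt0 : (0 < Nt)%N) (kappa0 : 0 < kappa) (alpha01 : 0 <= alpha <= 1).
Local Notation C := R[i].

(** For positive semidefinite [Q] the diagonal is real, so the real part is the entry itself. *)
Definition antenna_power (Q : 'M[C]_Nt) (n : 'I_Nt) : R := complex.Re (Q n n).

(** The unit total power is already substituted: the average power in the distortion model is
    [1 / Nt]. *)
Definition distortion (q : R) : R :=
  kappa ^+ 2 * ((1 - alpha) * q + alpha / Nt%:R).

Lemma antenna_powerE (Q : 'M[C]_Nt) n : psd Q -> Q n n = (antenna_power Q n)%:C.
Proof.
by move=> /(psd_diag_ge0 n) /ger0_Im; rewrite /antenna_power; case: (Q n n) => a b /= ->.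
Qed.

Lemma antenna_power_ge0 (Q : 'M[C]_Nt) n : psd Q -> 0 <= antenna_power Q n.
Proof. by move=> pQ; rewrite -ler0c -antenna_powerE//; exact: psd_diag_ge0. Qed.

Lemma sum_antenna_power (Q : 'M[C]_Nt) : admissible Q -> \sum_n antenna_power Q n = 1.
Proof.
move=> [pQ trQ]; apply: (@complexI R); rewrite rmorph_sum rmorph1 -trQ /=.
by apply: eq_bigr => n _; rewrite -antenna_powerE.
Qed.

Lemma distortion_ge0 q : 0 <= q -> 0 <= distortion q.
Proof.
move=> q0; case/andP: alpha01 => a0 a1.
rewrite mulr_ge0 ?sqr_ge0// addr_ge0//; first by rewrite mulr_ge0// subr_ge0.
by rewrite divr_ge0.
Qed.

(** Both summands are nonnegative, so both vanish; the second forces [alpha = 0], and the first then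
    reduces to [q]. An antenna free of distortion is thus idle, which handles singular distortion
    covariances. *)
Lemma distortion_eq0 q : 0 <= q -> distortion q = 0 -> q = 0.
Proof.
move=> q0 /eqP; case/andP: alpha01 => a0 a1.
have N0 : 0 < Nt%:R :> R by rewrite ltr0n.
rewrite mulf_eq0 sqrf_eq0 (gt_eqF kappa0)/= paddr_eq0; last 2 first.
- by rewrite mulr_ge0// subr_ge0.
- by rewrite divr_ge0// ltW.
rewrite !mulf_eq0 invr_eq0 (gt_eqF N0) orbF => /andP[/orP[|/eqP //] + /eqP a_eq0].
by rewrite a_eq0 subr0 oner_eq0.
Qed.

Lemma UpsilonE (Q : 'M[C]_Nt) : admissible Q ->
  Upsilon kappa alpha Q = diag_mx (\row_j (distortion (antenna_power Q j))%:C).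
Proof.
move=> [pQ trQ]; rewrite /Upsilon; congr diag_mx; apply/rowP => j; rewrite !mxE.
rewrite -/(\tr Q) trQ mulr1 antenna_powerE// /distortion.
by rewrite !(rmorphM, rmorphD, rmorphB, fmorphV, rmorph_nat, rmorph1).
Qed.

Lemma psd_Upsilon (Q : 'M[C]_Nt) : admissible Q -> psd (Upsilon kappa alpha Q).
Proof.
move=> aQ; rewrite UpsilonE//; apply: psd_diag => i; apply: distortion_ge0.
by apply: antenna_power_ge0; case: aQ.
Qed.

(* Concavity of [q / distortion q], through its tangent at [q = 1 / Nt]; with
   [x / 0 = 0] this also covers an idle antenna with [distortion q = 0]. *)
Lemma distortion_tangent q : 0 <= q ->
  q / distortion q <= (kappa ^+ 2)^-1 * (1 + alpha * (Nt%:R * q - 1)).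
Proof.
move=> q0; case/andP: alpha01 => a0 a1; rewrite /distortion.
have N0 : 0 < Nt%:R :> R by rewrite ltr0n.
set D := (1 - alpha) * q + alpha / Nt%:R.
rewrite invfM mulrCA ler_pM2l ?invr_gt0 ?exprn_gt0//.
have DN : Nt%:R * D = (1 - alpha) * (Nt%:R * q) + alpha.
  by rewrite /D mulrDr mulrCA [_ * (alpha / _)]mulrC divfK// gt_eqF.
have D0 : 0 <= D.
  by rewrite addr_ge0 ?mulr_ge0 ?subr_ge0// ?divr_ge0// ltW.
have Nq0 : 0 <= Nt%:R * q by rewrite mulr_ge0// ltW.
have [D_eq0|DN0] := eqVneq D 0.
  rewrite D_eq0 invr0 mulr0; nra.
have Dp : 0 < D by rewrite lt_def DN0.
rewrite ler_pdivrMr// -(ler_pM2l N0) [leRHS]mulrCA DN.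
set x := Nt%:R * q in Nq0 *.
rewrite -subr_ge0 (_ : _ - x = alpha * (1 - alpha) * (x - 1) ^+ 2); last by ring.
by rewrite mulr_ge0 ?sqr_ge0// mulr_ge0 ?subr_ge0.
Qed.

(** When the tangent bounds are summed over the antennas, their linear parts cancel because the
    powers add up to 1. *)
Lemma sum_distortion_ratio (Q : 'M[C]_Nt) : admissible Q ->
  \sum_n antenna_power Q n / distortion (antenna_power Q n) <= Nt%:R / kappa ^+ 2.
Proof.
move=> aQ; have [pQ _] := aQ.
apply: le_trans (ler_sum _ (fun n _ => distortion_tangent (antenna_power_ge0 n pQ))) _.
rewrite -mulr_sumr big_split /= sumr_const cardT size_enum_ord -mulr_sumr sumrB.
rewrite -mulr_sumr sum_antenna_power// sumr_const cardT size_enum_ord mulr1 subrr.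
by rewrite mulr0 addr0 mulrC.
Qed.


(* For [Q = V herm V], the determinant in [rate_H] is that of [1 + gain s H U V],
   where the SNR only enters through the regularization [s^-1]. *)
Definition gain (s : R) (H : 'M[C]_(Nr, Nt)) (U V : 'M[C]_Nt) : 'M[C]_Nt :=
  herm (H *m V) *m invmx (H *m U *m herm H + (s^-1)%:C%:M) *m (H *m V).

(** Pulling [s] out of the inverse cancels the prefactor [s] and leaves the regularization [s^-1];
    cycling [H *m V] to the right end then gives [gain]. *)
Lemma det_gain (s : R) (H : 'M[C]_(Nr, Nt)) (U V : 'M[C]_Nt) : 0 < s -> psd U ->
  \det (1%:M + s%:C *: (H *m (V *m herm V) *m herm H) *m
                invmx (s%:C *: (H *m U *m herm H) + 1%:M)) =
  \det (1%:M + gain s H U V).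
Proof.
move=> s0 pU; have sN0 : s%:C != 0 by rewrite eq_complex/= gt_eqF.
have uZ := unitmx_psdD (etrans (invr_gt0 s) s0) (psd_congr_herm H pU).
have -> : s%:C *: (H *m U *m herm H) + 1%:M =
    s%:C *: (H *m U *m herm H + (s^-1)%:C%:M).
  by rewrite scalerDr scale_scalar_mx -rmorphM /= mulfV ?gt_eqF.
rewrite invmxZ; last by rewrite unitmxZ ?unitfE.
rewrite -scalemxAl -scalemxAr scalerA mulfV// scale1r /gain.
set Zi := invmx _.
have -> : H *m (V *m herm V) *m herm H *m Zi = H *m V *m (herm (H *m V) *m Zi).
  by rewrite herm_mul !mulmxA.
exact: det1D_mulmxC.
Qed.

Lemma psd_gain (s : R) (H : 'M[C]_(Nr, Nt)) (U V : 'M[C]_Nt) : 0 < s -> psd U -> psd (gain s H U V).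
Proof.
move=> s0 pU; have s'0 : 0 < s^-1 by rewrite invr_gt0.
have pB := psd_congr_herm H pU.
apply: psd_congr; apply: psd_invmx (unitmx_psdD s'0 pB) _.
exact: psdD pB (psd_scalar _ (ltW s'0)).
Qed.

Lemma det_gain_mono (s s' : R) (H : 'M[C]_(Nr, Nt)) (U V : 'M[C]_Nt) : 0 < s -> s <= s' -> psd U ->
  \det (1%:M + gain s H U V) <= \det (1%:M + gain s' H U V).
Proof.
move=> s0 ss' pU; have s'0 := lt_le_trans s0 ss'.
apply: psd_det1D_mono (psd_gain H V s0 pU) _.
have pB := psd_congr_herm H pU.
have i0 : 0 < s^-1 by rewrite invr_gt0.
have i'0 : 0 < s'^-1 by rewrite invr_gt0.
rewrite /gain -mulmxBl -mulmxBr; apply: psd_congr.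
apply: psd_invmxB (unitmx_psdD i'0 pB) (unitmx_psdD i0 pB) _ _ _.
- exact: psdD pB (psd_scalar _ (ltW i'0)).
- exact: psdD pB (psd_scalar _ (ltW i0)).
- rewrite opprD addrACA subrr add0r -raddfB -rmorphB; apply: psd_scalar.
  by rewrite subr_ge0 lef_pV2.
Qed.

Lemma trace_gain_le (s : R) (H : 'M[C]_(Nr, Nt)) (V : 'M[C]_Nt) : 0 < s -> admissible (V *m herm V) ->
  \tr (gain s H (Upsilon kappa alpha (V *m herm V)) V) <= (Nt%:R / kappa ^+ 2)%:C.
Proof.
set Q := V *m herm V => s0 aQ; have [pQ _] := aQ.
set u := fun j => distortion (antenna_power Q j).
(* [W] is the pseudo-inverse of the distortion covariance applied to [V]: a zero variance is
   inverted to zero. *)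
set W := diag_mx (\row_j (u j)^-1%:C) *m V.
have UW : Upsilon kappa alpha Q *m W = V.
  rewrite UpsilonE// mulmxA mulmx_diag mul_diag_mx; apply/matrixP => i j; rewrite !mxE.
  rewrite -/(u i) -rmorphM /=.
  (* At an antenna with zero variance, [Q i i = 0] is the sum of the squared moduli of row [i] of
     [V]. That row is zero, so [U W = V] survives there. *)
  have [ui0|ui0] := eqVneq (u i) 0; last by rewrite mulfV// mul1r.
  have q0 : antenna_power Q i = 0.
    by apply: distortion_eq0 ui0; exact: antenna_power_ge0.
  have : Q i i = 0 by rewrite antenna_powerE// q0.
  rewrite mxE => /eqP; rewrite psumr_eq0 => [|k _]; last by rewrite hermE mulcJ_ge0.
  move=> /allP/(_ j (mem_index_enum _))/=; rewrite hermE mulf_eq0.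
  by rewrite fmorph_eq0 orbb => /eqP ->; rewrite mulr0.
have i0 : 0 < s^-1 by rewrite invr_gt0.
have := psd_trace_ge0 (psd_resolvent_le H W i0 (psd_Upsilon aQ)).
(* With [U W = V], the resolvent inequality bounds the trace of the gain by the trace of
   [herm W *m V], which is the sum of the ratios of power to distortion. *)
rewrite -!(mulmxA _ _ W) UW raddfB /= subr_ge0 => /le_trans; apply.
rewrite mxtrace_mulC /W herm_mul herm_diag mulmxA -/Q.
apply: le_trans (_ : _ <= (\sum_n antenna_power Q n / u n)%:C) _; last first.
  by rewrite lecR; exact: sum_distortion_ratio.
rewrite rmorph_sum /= /mxtrace le_eqVlt; apply/orP; left; apply/eqP.
by apply: eq_bigr => i _; rewrite mul_mx_diag mxE (antenna_powerE i pQ) mxE rmorphM.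
Qed.

Lemma det_gain_le (s : R) (H : 'M[C]_(Nr, Nt)) (V : 'M[C]_Nt) : (0 < Nr)%N -> 0 < s -> admissible (V *m herm V) ->
  \det (1%:M + gain s H (Upsilon kappa alpha (V *m herm V)) V) <=
  ((1 + Nt%:R / ((minn Nt Nr)%:R * kappa ^+ 2)) ^+ minn Nt Nr)%:C.
Proof.
move=> Nr0 s0 aQ; have trG := trace_gain_le H s0 aQ; move: trG.
set U := Upsilon _ _ _; have pU : psd U := psd_Upsilon aQ.
have i0 : 0 < s^-1 by rewrite invr_gt0.
have pB := psd_congr_herm H pU.
have pZ := psdD pB (psd_scalar _ (ltW i0)).
have [S SE] := psd_sqrt (psd_invmx (unitmx_psdD i0 pB) pZ).
(* Splitting the inverse as [S *m herm S] exhibits the gain as the Gram matrix of an [Nr] by [Nt]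
   matrix, so the determinant bound holds with exponent [min(Nt, Nr)]. *)
have -> : gain s H U V = herm (herm S *m (H *m V)) *m (herm S *m (H *m V)).
  by rewrite /gain SE [herm (herm S *m _)]herm_mul hermK !mulmxA.
move=> trG; apply: le_trans (gram_det_le _ Nr0 Nt0) _.
set T := \tr _ in trG *.

have T0 : 0 <= T by apply: psd_trace_ge0; exact: psd_gram.
have M0 : 0 < (minn Nt Nr)%:R :> R by rewrite ltr0n leq_min Nt0.
have TE : (1 + Nt%:R / ((minn Nt Nr)%:R * kappa ^+ 2))%:C =
    1 + (Nt%:R / kappa ^+ 2)%:C / (minn Nt Nr)%:R :> C.
  have -> : (minn Nt Nr)%:R^-1 = ((minn Nt Nr)%:R^-1)%:C :> C.
    by rewrite fmorphV rmorph_nat.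
  rewrite rmorphD rmorph1 -rmorphM /= invfM [_^-1 * _]mulrC.
  by rewrite mulrA.
have Mi0 : 0 <= (minn Nt Nr)%:R^-1 :> C by rewrite invr_ge0 ler0n.
rewrite rmorphXn/= TE lerXn2r ?nnegrE.
- by [].
- by rewrite addr_ge0// mulr_ge0.
- by rewrite addr_ge0// mulr_ge0// (le_trans T0 trG).
- by rewrite lerD2l ler_wpM2r.
Qed.

(** * Sign, monotonicity and upper bound of the rate at a fixed channel *)

Lemma log2_le (x y : R) : 0 < x -> x <= y -> log2 x <= log2 y.
Proof.
move=> x0 xy; rewrite /log2 ler_pM2r ?invr_gt0 ?ln_gt0 ?ltr1n//.
by rewrite ler_ln ?posrE// (lt_le_trans x0).
Qed.

Lemma log2_1 : log2 1 = 0 :> R. Proof. by rewrite /log2 ln1 mul0r. Qed.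

(** The factor [V] is chosen before [s] and [H], so that rates at two SNRs are compared through the
    same [V]. *)
Lemma rate_H_gain (Q : 'M[C]_Nt) : admissible Q -> exists V : 'M[C]_Nt,
  Q = V *m herm V /\ forall (s : R) (H : 'M[C]_(Nr, Nt)), 0 < s -> rate_H kappa alpha s H Q =
    log2 (complex.Re (\det (1%:M + gain s H (Upsilon kappa alpha Q) V))).
Proof.
move=> aQ; have [V QE] := psd_sqrt aQ.1; exists V; split; first exact: QE.
move=> s H s0; rewrite -(det_gain H V s0 (psd_Upsilon aQ)) -QE.
exact: erefl.
Qed.

Lemma Re_det_gain_ge1 (s : R) (H : 'M[C]_(Nr, Nt)) (U V : 'M[C]_Nt) : 0 < s -> psd U ->
  1 <= complex.Re (\det (1%:M + gain s H U V)).
Proof.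
by move=> s0 pU; have := psd_det1D_ge1 (psd_gain H V s0 pU); rewrite lecE => /andP[].
Qed.

Lemma rate_H_ge0 (s : R) (H : 'M[C]_(Nr, Nt)) (Q : 'M[C]_Nt) : 0 < s -> admissible Q ->
  0 <= rate_H kappa alpha s H Q.
Proof.
move=> s0 aQ; have [V [_ ->//]] := rate_H_gain aQ.
by rewrite -log2_1; apply: log2_le => //; apply: Re_det_gain_ge1 => //; exact: psd_Upsilon.
Qed.

Lemma rate_H_mono (s s' : R) (H : 'M[C]_(Nr, Nt)) (Q : 'M[C]_Nt) : 0 < s -> s <= s' -> admissible Q ->
  rate_H kappa alpha s H Q <= rate_H kappa alpha s' H Q.
Proof.
move=> s0 ss' aQ; have [V [_ rE]] := rate_H_gain aQ.
have pU := psd_Upsilon aQ.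
rewrite (rE _ _ s0) (rE _ _ (lt_le_trans s0 ss')); apply: log2_le.
  by rewrite (lt_le_trans ltr01)// Re_det_gain_ge1.
by have := det_gain_mono H V s0 ss' pU; rewrite lecE => /andP[].
Qed.

Lemma rate_H_le (s : R) (H : 'M[C]_(Nr, Nt)) (Q : 'M[C]_Nt) : (0 < Nr)%N -> 0 < s -> admissible Q ->
  rate_H kappa alpha s H Q <=
  (minn Nt Nr)%:R * log2 (1 + Nt%:R / ((minn Nt Nr)%:R * kappa ^+ 2)).
Proof.
move=> Nr0 s0 aQ; have [V [QE rE]] := rate_H_gain aQ; rewrite (rE _ _ s0).
have pU := psd_Upsilon aQ; set x := 1 + _ / _.
have x0 : 0 < x by rewrite ltr_wpDr// divr_ge0// mulr_ge0// sqr_ge0.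
have -> : (minn Nt Nr)%:R * log2 x = log2 (x ^+ minn Nt Nr).
  by rewrite /log2 lnXn// -[ln x *+ _]mulr_natl mulrA.
apply: log2_le; first by rewrite (lt_le_trans ltr01)// Re_det_gain_ge1.
rewrite QE in aQ *.
by have := det_gain_le H Nr0 s0 aQ; rewrite lecE => /andP[].
Qed.

(** * Rate of the uniform covariance *)

Definition uniform_cov : 'M[C]_Nt := (Nt%:R)^-1%:C *: 1%:M.

Lemma uniform_cov_admissible : admissible uniform_cov.
Proof.
split; first by apply: psdZ; [rewrite invr_ge0 ler0n | exact: psd1].
have NN0 : (Nt%:R : C) != 0 by rewrite pnatr_eq0 -lt0n.
by rewrite /uniform_cov mxtraceZ mxtrace1 fmorphV rmorph_nat mulVf.
Qed.

(** Every antenna has the average power [1 / Nt], so the weights [1 - alpha] and [alpha] recombine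
    to 1. *)
Lemma Upsilon_uniform :
  Upsilon kappa alpha uniform_cov = (kappa ^+ 2)%:C *: uniform_cov.
Proof.
rewrite (UpsilonE uniform_cov_admissible).
transitivity (diag_mx (const_mx (kappa ^+ 2 / Nt%:R)%:C) : 'M[C]_Nt).
  congr diag_mx; apply/rowP => j; rewrite !mxE /antenna_power !mxE eqxx mulr1.
  by rewrite /distortion /= -mulrDl subrK mul1r.
by rewrite diag_const_mx /uniform_cov !scale_scalar_mx mulr1 rmorphM.
Qed.

Lemma log2_prod I (r : seq I) (F : I -> R) : (forall i, 0 < F i) ->
  log2 (\prod_(i <- r) F i) = \sum_(i <- r) log2 (F i).
Proof.
move=> F0; elim: r => [|i r IHr]; first by rewrite !big_nil log2_1.
rewrite !big_cons -IHr /log2 lnM ?posrE ?mulrDl//.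
by apply: prodr_gt0.
Qed.

(** The [d i] are the eigenvalues of [H *m uniform_cov *m herm H]. As the distortion covariance is a
    multiple of [uniform_cov], every matrix in the rate is diagonal in one eigenbasis. *)
Lemma rate_H_uniform (H : 'M[C]_(Nr, Nt)) : exists d : 'I_Nr -> R,
  [/\ forall i, 0 <= d i, #|[pred i | d i != 0]| = \rank H &
    forall s, 0 < s -> rate_H kappa alpha s H uniform_cov =
      \sum_i log2 (1 + s * d i / (s * (kappa ^+ 2 * d i) + 1))].
Proof.
have [pQ _] := uniform_cov_admissible.
have := psd_spectral (psd_congr_herm H pQ).
move=> [P [d [PP d0 AE]]].
(* [f g] has eigenbasis [P] and eigenvalues [g]. The next facts make [f] linear, multiplicative and
   unital, so the whole expression can be computed on eigenvalues. *)
pose f (g : 'I_Nr -> R) := herm P *m diag_mx (\row_j (g j)%:C) *m P.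
have fM g h : f g *m f h = f (fun i => g i * h i).
  rewrite /f -!mulmxA (mulmxA P) (mulmx1C PP) mul1mx !mulmxA; congr (_ *m P).
  rewrite -mulmxA mulmx_diag; congr (_ *m diag_mx _); apply/rowP => j.
  by rewrite !mxE rmorphM.
have fZ c g : c%:C *: f g = f (fun i => c * g i).
  rewrite /f scalemxAl scalemxAr -linearZ /=; congr (_ *m diag_mx _ *m _).
  by apply/rowP => j; rewrite !mxE rmorphM.
have fD g h : f g + f h = f (fun i => g i + h i).
  rewrite /f -mulmxDl -mulmxDr -linearD /=; congr (_ *m diag_mx _ *m _).
  by apply/rowP => j; rewrite !mxE rmorphD.
have f1 : f (fun=> 1) = 1%:M.
  rewrite /f (_ : diag_mx _ = 1%:M) ?mulmx1//.
  by rewrite -diag_const_mx; congr diag_mx; apply/rowP => j; rewrite !mxE.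
have fdet g : \det (1%:M + f g) = (\prod_i (1 + g i))%:C.
  rewrite /f unitary_conj_det// det1D_diag rmorph_prod.
  by apply: eq_bigr => i _; rewrite rmorphD rmorph1.
exists d; split => //.
  have NN0 : (Nt%:R : C)^-1 != 0 by rewrite invr_eq0 pnatr_eq0 -lt0n.
  (* The nonzero scalar [1 / Nt] keeps the rank, and [H *m herm H] has the rank of [H]; removing the
     invertible [P] on both sides then leaves a diagonal matrix. *)
  have <- : \rank (H *m uniform_cov *m herm H) = \rank H.
    rewrite -scalemxAr mulmx1 -scalemxAl fmorphV rmorph_nat.
    by rewrite (eqmx_scale _ NN0) mxrank_mul_herm.
  rewrite AE mxrankMfree; last first.
    by rewrite row_free_unit; have [] := mulmx1_unit PP.
  rewrite -mxrank_tr trmx_mul mxrankMfree; last first.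
    rewrite row_free_unit unitmx_tr; by have [] := mulmx1_unit PP.
  rewrite mxrank_tr mxrank_diag; apply: eq_card => i.
  by rewrite !inE mxE fmorph_eq0.
have HU : H *m ((kappa ^+ 2)%:C *: uniform_cov) *m herm H = (kappa ^+ 2)%:C *: f d.
  by rewrite /f -AE scalemxAl; congr (_ *m _); exact: esym (scalemxAr _ _ _).
move=> s s0.
have -> : rate_H kappa alpha s H uniform_cov = log2 (complex.Re (\det (1%:M +
    s%:C *: f d *m invmx (s%:C *: ((kappa ^+ 2)%:C *: f d) + 1%:M)))).
  by rewrite -HU -Upsilon_uniform /f -AE.
have k0 i : 0 < s * (kappa ^+ 2 * d i) + 1.
  by rewrite ltr_wpDl// mulr_ge0 ?(ltW s0)// mulr_ge0// sqr_ge0.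
rewrite !fZ -[X in invmx (_ + X)]f1 fD.
set Z := (X in invmx X).
have ZV : Z *m f (fun i => (s * (kappa ^+ 2 * d i) + 1)^-1) = 1%:M.
  rewrite fM -f1 /f; congr (_ *m diag_mx _ *m _); apply/rowP => j.
  by rewrite !mxE mulfV// gt_eqF.
have uZ : Z \in unitmx := (mulmx1_unit ZV).1.
have -> : invmx Z = f (fun i => (s * (kappa ^+ 2 * d i) + 1)^-1).
  by rewrite -[LHS]mulmx1 -ZV mulKmx.
rewrite fM fdet /= log2_prod// => i.
by rewrite ltr_wpDr// divr_ge0 ?(ltW (k0 i))// mulr_ge0// ltW.
Qed.

End Channel.

(** * Measurability of complex matrix expressions *)

Section ComplexMeasurability.
Context {R : realType} {d : measure_display} {T : measurableType d}.
Local Notation C := R[i].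

(** Measurability is split into real and imaginary parts, the form in which the channel entries are
    assumed measurable. *)
Definition cmeasurable (f : T -> C) :=
  measurable_fun setT (fun w => complex.Re (f w)) /\
  measurable_fun setT (fun w => complex.Im (f w)).

Lemma cmeasurable_cst (c : C) : cmeasurable (fun=> c).
Proof. by split; exact: measurable_cst. Qed.

Lemma cmeasurableD (f g : T -> C) :
  cmeasurable f -> cmeasurable g -> cmeasurable (fun w => f w + g w).
Proof.
move=> [rf jf] [rg jg]; split.
  rewrite (_ : (fun _ => _) = (fun w => complex.Re (f w)) \+ (fun w => complex.Re (g w))).
    exact: measurable_funD.
  by apply/funext => w /=; case: (f w); case: (g w).
rewrite (_ : (fun _ => _) = (fun w => complex.Im (f w)) \+ (fun w => complex.Im (g w))).
  exact: measurable_funD.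
by apply/funext => w /=; case: (f w); case: (g w).
Qed.

Lemma cmeasurableM (f g : T -> C) :
  cmeasurable f -> cmeasurable g -> cmeasurable (fun w => f w * g w).
Proof.
move=> [rf jf] [rg jg]; split.
  rewrite (_ : (fun _ => _) =
    ((fun w => complex.Re (f w)) \* (fun w => complex.Re (g w))) \-
    ((fun w => complex.Im (f w)) \* (fun w => complex.Im (g w)))).
    by apply: measurable_funB; exact: measurable_funM.
  by apply/funext => w /=; case: (f w); case: (g w).
rewrite (_ : (fun _ => _) =
  ((fun w => complex.Re (f w)) \* (fun w => complex.Im (g w))) \+
  ((fun w => complex.Im (f w)) \* (fun w => complex.Re (g w)))).
  by apply: measurable_funD; exact: measurable_funM.
by apply/funext => w /=; case: (f w); case: (g w).
Qed.

Lemma cmeasurable_conj (f : T -> C) :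
  cmeasurable f -> cmeasurable (fun w => conjc (f w)).
Proof.
move=> [rf jf]; split.
  by rewrite (_ : (fun _ => _) = fun w => complex.Re (f w))//; apply/funext => w; case: (f w).
rewrite (_ : (fun _ => _) = \- (fun w => complex.Im (f w))); first exact: measurable_funN.
by apply/funext => w /=; case: (f w).
Qed.

Lemma cmeasurable_sum I (r : seq I) (F : I -> T -> C) :
  (forall i, cmeasurable (F i)) -> cmeasurable (fun w => \sum_(i <- r) F i w).
Proof.
move=> mF; elim: r => [|i r IHr].
  by under eq_fun do rewrite big_nil; exact: cmeasurable_cst.
by under eq_fun do rewrite big_cons; exact: cmeasurableD.
Qed.

Lemma cmeasurable_prod I (r : seq I) (F : I -> T -> C) :
  (forall i, cmeasurable (F i)) -> cmeasurable (fun w => \prod_(i <- r) F i w).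
Proof.
move=> mF; elim: r => [|i r IHr].
  by under eq_fun do rewrite big_nil; exact: cmeasurable_cst.
by under eq_fun do rewrite big_cons; exact: cmeasurableM.
Qed.

Definition mxmeasurable m n (A : T -> 'M[C]_(m, n)) :=
  forall i j, cmeasurable (fun w => A w i j).

Lemma mxmeasurable_cst m n (A : 'M[C]_(m, n)) : mxmeasurable (fun=> A).
Proof. by move=> i j; exact: cmeasurable_cst. Qed.

Lemma mxmeasurableD m n (A B : T -> 'M[C]_(m, n)) :
  mxmeasurable A -> mxmeasurable B -> mxmeasurable (fun w => A w + B w).
Proof.
by move=> mA mB i j; under eq_fun do rewrite mxE; exact: cmeasurableD.
Qed.

Lemma mxmeasurableM m n p (A : T -> 'M[C]_(m, n)) (B : T -> 'M[C]_(n, p)) :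
  mxmeasurable A -> mxmeasurable B -> mxmeasurable (fun w => A w *m B w).
Proof.
move=> mA mB i j; under eq_fun do rewrite mxE.
by apply: cmeasurable_sum => k; exact: cmeasurableM.
Qed.

Lemma mxmeasurableZ m n (c : C) (A : T -> 'M[C]_(m, n)) :
  mxmeasurable A -> mxmeasurable (fun w => c *: A w).
Proof.
move=> mA i j; under eq_fun do rewrite mxE.
by apply: cmeasurableM (mA i j); exact: cmeasurable_cst.
Qed.

Lemma mxmeasurable_herm m n (A : T -> 'M[C]_(m, n)) :
  mxmeasurable A -> mxmeasurable (fun w => herm (A w)).
Proof.
by move=> mA i j; under eq_fun do rewrite hermE; exact: cmeasurable_conj.
Qed.

Lemma cmeasurable_det n (A : T -> 'M[C]_n) :
  mxmeasurable A -> cmeasurable (fun w => \det (A w)).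
Proof.
move=> mA; apply: cmeasurable_sum => s; apply: cmeasurableM.
  exact: cmeasurable_cst.
by apply: cmeasurable_prod => i; exact: mA.
Qed.
End ComplexMeasurability.

(** For [x > 0] and [s > 0] the ratio equals [(k + s^-1 x^-1)^-1], which tends to [k^-1]; for
    [x = 0] it vanishes. Each nonzero eigenvalue thus contributes the same limit, whatever its
    size. *)
Lemma cvg_log2_ratio (R : realType) (k x : R) : 0 < k -> 0 <= x ->
  log2 (1 + s * x / (s * (k * x) + 1)) @[s --> +oo] -->
  (x != 0)%:R * log2 (1 + k^-1).
Proof.
move=> k0; rewrite le_eqVlt => /predU1P[<-|x0].
  rewrite eqxx mul0r; under eq_fun do rewrite !mulr0 mul0r addr0 log2_1.
  exact: cvg_cst.
rewrite gt_eqF// mul1r.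
have cvgV0 : s^-1 @[s --> +oo] --> (0 : R).
  by apply/gtr0_cvgV0; [exact: nbhs_pinfty_gt | exact: cvg_id].
have cvgB : (k + s^-1 * x^-1)^-1 @[s --> +oo] --> k^-1.
  apply: cvgV; first by rewrite gt_eqF.
  rewrite -[X in _ --> X]addr0; apply: cvgD; first exact: cvg_cst.
  by rewrite -(mul0r x^-1); apply: cvgMr_tmp.
have cvgL : ln (1 + (k + s^-1 * x^-1)^-1) / ln 2 @[s --> +oo] --> log2 (1 + k^-1).
  apply: cvgMr_tmp; apply: (@continuous_cvg _ _ _ _ _ _ (@ln R)).
    by apply: continuous_ln; rewrite ltr_wpDr// invr_ge0 ltW.
  by apply: cvgD cvgB; exact: cvg_cst.
apply: cvg_trans cvgL; apply: near_eq_cvg; near=> s.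
have s0 : 0 < s by near: s; exact: nbhs_pinfty_gt.
rewrite /log2; congr (ln (1 + _) / _).
have D0 : 0 < s * (k * x) + 1 by rewrite ltr_wpDl// !mulr_ge0// ltW.
by field; rewrite !gt_eqF.
Unshelve. all: by end_near. Qed.

(** * Ergodic rates and the capacity limit *)

Section Ergodic.
Variables (R : realType) (d : measure_display) (T : measurableType d).
Variables (P : probability T R) (Nt Nr : nat) (H : T -> 'M[R[i]]_(Nr, Nt)).
Variables (kappa alpha : R).
Hypotheses (Nt0 : (0 < Nt)%N) (Nr0 : (0 < Nr)%N).
Hypotheses (kappa0 : 0 < kappa) (alpha01 : 0 <= alpha <= 1).
Hypothesis mH : mxmeasurable H.
Local Notation M := (minn Nt Nr).
Local Notation ub := (M%:R * log2 (1 + Nt%:R / (M%:R * kappa ^+ 2))).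
Local Notation lb := (M%:R * log2 (1 + (kappa ^+ 2)^-1)).

(** Since [1 + X (1 + Y)^-1 = (1 + Y + X) (1 + Y)^-1], the rate is a difference of two
    log-determinants. No matrix inverse remains, and determinants are polynomial in the entries,
    which gives measurability in the channel. *)
Lemma rate_HE s (A : 'M[R[i]]_(Nr, Nt)) Q : 0 < s -> admissible Q ->
  rate_H kappa alpha s A Q = (ln (complex.Re (\det (1%:M +
      (s%:C *: (A *m Upsilon kappa alpha Q *m herm A) + s%:C *: (A *m Q *m herm A))))) -
    ln (complex.Re (\det (1%:M + s%:C *: (A *m Upsilon kappa alpha Q *m herm A))))) / ln 2.
Proof.
move=> s0 aQ; have [pQ _] := aQ.
have pX : psd (s%:C *: (A *m Q *m herm A)).
  exact: psdZ (ltW s0) (psd_congr_herm A pQ).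
have pY : psd (s%:C *: (A *m Upsilon kappa alpha Q *m herm A)).
  exact: psdZ (ltW s0) (psd_congr_herm A (psd_Upsilon kappa alpha01 aQ)).
rewrite /rate_H.
move: (s%:C *: (A *m Q *m herm A)) pX => X pX.
move: (s%:C *: (A *m Upsilon kappa alpha Q *m herm A)) pY => Y pY.
have uZ : 1%:M + Y \in unitmx by rewrite addrC; exact: (unitmx_psdD ltr01 pY).
rewrite (addrC Y 1%:M).
have dY := psd_det1D_ge1 pY; have dXY := psd_det1D_ge1 (psdD pY pX).
have -> : 1%:M + X *m invmx (1%:M + Y) = (1%:M + (Y + X)) *m invmx (1%:M + Y).
  by rewrite addrA mulmxDl (mulmxV uZ).
rewrite det_mulmx det_inv.
(* A complex number that is at least 1 is real and positive, so real parts commute with the quotient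
   of the two determinants. *)
have realE (z : R[i]) : 1 <= z -> z = (complex.Re z)%:C /\ 0 < complex.Re z.
  by case: z => a b; rewrite lecE /= => /andP[/eqP -> a1]; rewrite (lt_le_trans _ a1).
have [eY Y0] := realE _ dY; have [eXY XY0] := realE _ dXY.
by rewrite {1}eY {1}eXY -fmorphV -rmorphM /= /log2 ln_div.
Qed.

Lemma measurable_rate_H s Q : 0 < s -> admissible Q ->
  measurable_fun setT (fun w => rate_H kappa alpha s (H w) Q).
Proof.
move=> s0 aQ; under eq_fun do rewrite rate_HE//.
apply: measurable_funM; last exact: measurable_cst.
have mB (B : 'M[R[i]]_Nt) : mxmeasurable (fun w => s%:C *: (H w *m B *m herm (H w))).
  apply: mxmeasurableZ; apply: mxmeasurableM (mxmeasurable_herm mH).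
  exact: mxmeasurableM mH (mxmeasurable_cst B).
have mln (Y : T -> 'M[R[i]]_Nr) : mxmeasurable Y ->
    measurable_fun setT (fun w => ln (complex.Re (\det (1%:M + Y w)))).
  move=> mY; apply: (measurableT_comp (@measurable_ln R)).
  by apply: (cmeasurable_det _).1; apply: mxmeasurableD mY; exact: mxmeasurable_cst.
by apply: measurable_funB; apply: mln; [exact: mxmeasurableD | exact: mB].
Qed.

Local Open Scope ereal_scope.

Lemma integral_probability_cst (r : R) : \int[P]_w (cst r%:E) w = r%:E.
Proof.
rewrite integral_cst; last exact: measurableT.
by rewrite [X in _ * X](_ : _ = 1) ?mule1//; exact: probability_setT.
Qed.

Lemma emeasurable_rate_H s Q : (0 < s)%R -> admissible Q ->
  measurable_fun setT (fun w => (rate_H kappa alpha s (H w) Q)%:E).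
Proof. by move=> s0 aQ; apply/measurable_EFinP; exact: measurable_rate_H. Qed.

Lemma rate_mono s s' Q : (0 < s)%R -> (s <= s')%R -> admissible Q ->
  rate P H kappa alpha s Q <= rate P H kappa alpha s' Q.
Proof.
move=> s0 ss' aQ; have s'0 := lt_le_trans s0 ss'.
apply: ge0_le_integral.
- exact: measurableT.
- by move=> w _; rewrite lee_fin; exact: (rate_H_ge0 kappa alpha01 (H w) s0 aQ).
- exact: emeasurable_rate_H s0 aQ.
- exact: emeasurable_rate_H s'0 aQ.
- by move=> w _; rewrite lee_fin; exact: (rate_H_mono kappa alpha01 (H w) s0 ss' aQ).
Qed.

Lemma rate_le s Q : (0 < s)%R -> admissible Q -> rate P H kappa alpha s Q <= ub%:E.
Proof.
move=> s0 aQ; rewrite -[leRHS]integral_probability_cst.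
apply: ge0_le_integral.
- exact: measurableT.
- by move=> w _; rewrite lee_fin; exact: (rate_H_ge0 kappa alpha01 (H w) s0 aQ).
- exact: emeasurable_rate_H s0 aQ.
- exact: measurable_cst.
- by move=> w _; rewrite lee_fin; exact: (rate_H_le Nt0 kappa0 alpha01 (H w) Nr0 s0 aQ).
Qed.

Lemma capacity_mono s s' : (0 < s)%R -> (s <= s')%R ->
  capacity P H kappa alpha s <= capacity P H kappa alpha s'.
Proof.
move=> s0 ss'; apply: ge_ereal_sup => _ [Q aQ <-].
apply: le_trans (rate_mono s0 ss' aQ) _.
by apply: ereal_sup_ubound; exists Q.
Qed.

Lemma capacity_le s : (0 < s)%R -> capacity P H kappa alpha s <= ub%:E.
Proof. by move=> s0; apply: ge_ereal_sup => _ [Q aQ <-]; exact: rate_le. Qed.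


Lemma rate_uniform_cvg : {ae P, forall w, \rank (H w) = M} ->
  rate P H kappa alpha s (uniform_cov R Nt) @[s --> +oo%R] --> lb%:E.
Proof.
move=> rankH; have aU := uniform_cov_admissible R Nt0.
(* The rate estimates require a positive SNR; clipping at 1 ensures it everywhere and changes
   nothing near infinity. *)
suff : rate P H kappa alpha (Num.max s 1%R) (uniform_cov R Nt) @[s --> +oo%R] --> lb%:E.
  apply: cvg_trans; apply: near_eq_cvg; near=> s.
  by rewrite max_l//; near: s; exact: nbhs_pinfty_ge.
(* Dominated convergence is stated for sequences, so the limit is tested along every sequence
   tending to infinity; the constant upper bound dominates. *)
apply/cvge_pinftyP => u uoo.
have v0 n : (0 < Num.max (u n) 1)%R by rewrite lt_max ltr01 orbT.
have voo : Num.max (u n) 1%R @[n --> \oo] --> +oo%R.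
  apply: cvg_trans (uoo); apply: near_eq_cvg; near=> n.
  by rewrite max_l//; near: n; apply: (cvgry_ge uoo).
rewrite -[lb%:E]integral_probability_cst.
have [|||||_ _ rate_cvg] := @dominated_convergence _ _ _ P setT measurableT
  (fun n w => (rate_H kappa alpha (Num.max (u n) 1%R) (H w) (uniform_cov R Nt))%:E)
  (cst lb%:E) (cst ub%:E) _ _ _ _ _.
- by move=> n; exact: emeasurable_rate_H (v0 n) aU.
- exact: measurable_cst.
- apply: filterS rankH => w rankHw _.
  have [e [e0 e_card rE]] := rate_H_uniform kappa alpha Nt0 (H w).
  apply: cvg_EFin; first exact: nearW.
  rewrite (_ : _ \o _ = fun n => (\sum_i log2 (1 + Num.max (u n) 1 * e i /
      (Num.max (u n) 1 * (kappa ^+ 2 * e i) + 1)))%R); last first.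
    by apply/funext => n /=; rewrite rE.
  (* The number of nonzero eigenvalues is the rank of the channel, almost surely [M], so [lb] is a
     sum of indicators matching the termwise limits. *)
  have -> : lb = (\sum_i (e i != 0)%:R * log2 (1 + (kappa ^+ 2)^-1))%R.
    rewrite -mulr_suml -natr_sum -rankHw -e_card -sum1_card; congr (_%:R * _)%R.
    by rewrite big_mkcond; apply: eq_bigr => i _; rewrite inE; case: (_ != _).
  apply: cvg_big => [|i _]; first exact: add_continuous.
  have := cvg_log2_ratio (exprn_gt0 2 kappa0) (e0 i).
  exact: (cvg_comp _ _ voo).
- exact: finite_measure_integrable_cst.
- apply: nearW => w n _; rewrite gee0_abs lee_fin.
    exact: (rate_H_le Nt0 kappa0 alpha01 (H w) Nr0 (v0 n) aU).
  exact: (rate_H_ge0 kappa alpha01 (H w) (v0 n) aU).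
- exact: rate_cvg.
Unshelve. all: by end_near. Qed.

(** The capacity clipped at SNR 1 is nondecreasing on the whole line, so it converges to its
    supremum. The uniform upper bound caps this supremum, and the limiting rate of the uniform
    covariance bounds it below; hence it is finite. *)
Lemma capacity_cvg : {ae P, forall w, \rank (H w) = M} -> exists L : R,
  [/\ capacity P H kappa alpha s @[s --> +oo%R] --> L%:E, (lb <= L)%R & (L <= ub)%R].
Proof.
move=> rankH; pose c s := capacity P H kappa alpha (Num.max s 1%R).
have m0 (s : R) : (0 < Num.max s 1)%R by rewrite lt_max ltr01 orbT.
have c_nd : {homo c : s t / (s <= t)%R >-> s <= t}.
  by move=> s t st; apply: capacity_mono (m0 s) _; rewrite ge_max !le_max st lexx orbT.
have c_cvg := nondecreasing_cvge c_nd.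
have cap_cvg : capacity P H kappa alpha s @[s --> +oo%R] --> ereal_sup (range c).
  apply: cvg_trans (c_cvg); apply: near_eq_cvg; near=> s.
  by rewrite /c max_l//; near: s; exact: nbhs_pinfty_ge.
have sup_le : ereal_sup (range c) <= ub%:E.
  by apply: ge_ereal_sup => _ [s _ <-]; exact: capacity_le.
have sup_ge : lb%:E <= ereal_sup (range c).
  have aU := uniform_cov_admissible R Nt0.
  apply: cvge_le (rate_uniform_cvg rankH); near=> s.
  apply: (@le_trans _ _ (c s)); last by apply: ereal_sup_ubound; exists s.
  rewrite /c max_l; last by near: s; exact: nbhs_pinfty_ge.
  by apply: ereal_sup_ubound; exists (uniform_cov R Nt).
have sup_fin : ereal_sup (range c) \is a fin_num.
  by rewrite fin_numElt (lt_le_trans _ sup_ge) ?ltNyr// (le_lt_trans sup_le) ?ltry.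
exists (fine (ereal_sup (range c))).
by split; rewrite -?lee_fin ?fineK.
Unshelve. all: by end_near. Qed.

End Ergodic.

Theorem theorem1 (R : realType) (d : measure_display) (T : measurableType d)
  (P : probability T R) (Nt Nr : nat) (H : T -> 'M[R[i]]_(Nr, Nt))
  (kappa alpha : R) :
  (0 < Nt)%N -> (0 < Nr)%N ->
  0 < kappa -> 0 <= alpha <= 1 ->
  (forall (i : 'I_Nr) (j : 'I_Nt),
     measurable_fun setT (fun w => @complex.Re R (H w i j)) /\
     measurable_fun setT (fun w => @complex.Im R (H w i j))) ->
  (\int[P]_w (@complex.Re R (\tr (herm (H w) *m H w)))%:E)%E = ((Nt * Nr)%:R)%:E ->
  {ae P, forall w, \rank (H w) = minn Nt Nr} ->
  let M := minn Nt Nr in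
  exists L : R,
    (capacity P H kappa alpha snr @[snr --> +oo%R] --> L%:E) /\
    M%:R * log2 (1 + (kappa ^+ 2)^-1) <= L /\
    L <= M%:R * log2 (1 + Nt%:R / (M%:R * kappa ^+ 2)) /\
    (rate P H kappa alpha snr ((Nt%:R)^-1%:C *: 1%:M) @[snr --> +oo%R]
       --> (M%:R * log2 (1 + (kappa ^+ 2)^-1))%:E) /\
    ((Nt <= Nr)%N ->
       M%:R * log2 (1 + (kappa ^+ 2)^-1) = M%:R * log2 (1 + Nt%:R / (M%:R * kappa ^+ 2))).
Proof.
move=> Nt0 Nr0 kappa0 alpha01 mH _ rankH M.
have [L [cL lbL Lub]] := capacity_cvg Nt0 Nr0 kappa0 alpha01 mH rankH.
exists L; do 3 split => //; split.
  exact: rate_uniform_cvg.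
(* Here [M = Nt], so [Nt / (M kappa^2)] reduces to [1 / kappa^2]. *)
move=> NtNr; rewrite /M (minn_idPl NtNr); congr (_ * log2 (1 + _)).
by rewrite [in RHS]invfM mulrA mulfV ?mul1r// pnatr_eq0 -lt0n.
Qed.
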